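(* Let $I$ be a set. The variety of $I$-dimensional cylindric ortholattices is closed under canonical completions: for every $I$-dimensional cylindric ortholattice $A$ there exist an $I$-dimensional cylindric ortholattice $C$ whose underlying lattice is complete and an embedding (injective homomorphism) of $I$-dimensional cylindric ortholattices $e\colon A\to C$ such that $\langle e;C\rangle$ is a canonical completion of $A$.
   Context: An ortholattice is a bounded lattice $\langle A;\wedge,\vee,0,1\rangle$ with a unary operation ${}^{\perp}$ such that $a\wedge a^{\perp}=0$, $a\vee a^{\perp}=1$, $a\le b\Rightarrow b^{\perp}\le a^{\perp}$, and $a^{\perp\perp}=a$. A quantifier on an ortholattice $A$ is a map $\exists\colon A\to A$ with $\exists(a\vee b)=\exists a\vee\exists b$, $\exists 0=0$, $\exists\exists a=\exists a$, $a\le\exists a$, $\exists(\exists a)^{\perp}=(\exists a)^{\perp}$. An $I$-dimensional cylindric ortholattice is an ortholattice $A$ with unary operators $(\exists_i)_{i\in I}$ and constants $(\delta_{i,k})_{i,k\in I}$ such that for all $i,k,l\in I$: (1) $\exists_i$ is a quantifier; (2) $\exists_i\exists_k a=\exists_k\exists_i a$ for all $a\in A$; (3) $\delta_{i,k}=\delta_{k,i}$ and $\delta_{i,i}=1$; (4) if $i\neq k$ and $l\ne k$, then $\exists_k(\delta_{i,k}\wedge\delta_{k,l})=\delta_{i,l}$. Homomorphisms of $I$-dimensional cylindric ortholattices are bounded lattice homomorphisms preserving ${}^\perp$, every $\exists_i$ and every $\delta_{i,k}$. For a bounded lattice $A$, a canonical completion of $A$ is a pair $\langle e;C\rangle$ with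 $C$ a complete lattice and $e\colon A\to C$ a (bounded lattice) embedding that is dense (every element of $C$ is both a meet of joins and a join of meets of elements of $e[A]$) and compact (for all $S,T\subseteq A$ there are finite $S'\subseteq S$, $T'\subseteq T$ such that $\bigwedge e[S]\le\bigvee e[T]$ implies $\bigwedge e[S']\le\bigvee e[T']$). The canonical completion is unique up to isomorphism. *)

(* Defs.v *)
From HB Require Import structures.
From mathcomp Require Import all_boot all_order.
From mathcomp Require Import boolp classical_sets cardinality.

Set Implicit Arguments.
Unset Strict Implicit.
Unset Printing Implicit Defensive.

Import Order.LTheory.
Local Open Scope order_scope.

HB.mixin Record isOrtholattice (d : Order.disp_t) T
    of Order.TBLattice d T := {
  perp : T -> T;
  meet_perp : forall a : T, a `&` perp a = \bot;
  join_perp : forall a : T, a `|` perp a = \top;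
  perp_anti : forall a b : T, a <= b -> perp b <= perp a;
  perpK : forall a : T, perp (perp a) = a
}.

#[short(type="ortholatticeType")]
HB.structure Definition Ortholattice (d : Order.disp_t) :=
  {T of isOrtholattice d T & Order.TBLattice d T}.

Definition quantifier (d : Order.disp_t) (A : ortholatticeType d)
    (q : A -> A) : Prop :=
  [/\ forall a b, q (a `|` b) = q a `|` q b,
      q \bot = \bot,
      forall a, q (q a) = q a,
      forall a, a <= q a
    & forall a, q (perp (q a)) = perp (q a)].

HB.mixin Record isCylindric (I : Type) (d : Order.disp_t) T
    of Ortholattice d T := {
  cyl : I -> T -> T;
  diag : I -> I -> T;
  cyl_quantifier : forall i : I, quantifier (cyl i);
  cylC : forall (i k : I) (a : T), cyl i (cyl k a) = cyl k (cyl i a);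
  diagC : forall i k : I, diag i k = diag k i;
  diag_refl : forall i : I, diag i i = \top;
  cyl_diag : forall i k l : I, i <> k -> l <> k ->
    cyl k (diag i k `&` diag k l) = diag i l
}.

#[short(type="cylindricOrtholatticeType")]
HB.structure Definition CylindricOrtholattice (I : Type) (d : Order.disp_t) :=
  {T of isCylindric I d T & Ortholattice d T}.

(* Order.TBLatticeMorphism alone only asks for preservation of \bot and \top. *)
HB.structure Definition BoundedLatticeMorphism
    (d : Order.disp_t) (A : tbLatticeType d)
    (d' : Order.disp_t) (C : tbLatticeType d') :=
  {f of @Order.LatticeMorphism d A d' C f
      & @Order.TBLatticeMorphism d A d' C f}.

HB.mixin Record isCylindricMorphism (I : Type)
    (d : Order.disp_t) (A : cylindricOrtholatticeType I d)
    (d' : Order.disp_t) (C : cylindricOrtholatticeType I d') (f : A -> C) := {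
  morph_perp : forall a, f (perp a) = perp (f a);
  morph_cyl : forall (i : I) a, f (cyl i a) = cyl i (f a);
  morph_diag : forall i k : I, f (diag i k) = diag i k
}.

HB.structure Definition CylindricMorphism (I : Type)
    (d : Order.disp_t) (A : cylindricOrtholatticeType I d)
    (d' : Order.disp_t) (C : cylindricOrtholatticeType I d') :=
  {f of isCylindricMorphism I d A d' C f
      & @BoundedLatticeMorphism d A d' C f}.

Local Open Scope classical_set_scope.

Definition complete_lattice (d : Order.disp_t) (C : tbLatticeType d) : Prop :=
  forall S : set C, supremums S !=set0 /\ infimums S !=set0.

(* The default values are the join and the meet of the empty set. *)
Definition bigjoin (d : Order.disp_t) (C : tbLatticeType d) (S : set C) : C :=
  supremum \bot S.
Definition bigmeet (d : Order.disp_t) (C : tbLatticeType d) (S : set C) : C :=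
  infimum \top S.

Definition dense_map (d d' : Order.disp_t) (A : tbLatticeType d)
    (C : tbLatticeType d') (e : A -> C) : Prop :=
  forall x : C,
    (exists F : set (set A), x = bigmeet [set bigjoin (e @` S) | S in F]) /\
    (exists F : set (set A), x = bigjoin [set bigmeet (e @` S) | S in F]).

Definition compact_map (d d' : Order.disp_t) (A : tbLatticeType d)
    (C : tbLatticeType d') (e : A -> C) : Prop :=
  forall S T : set A, exists S' T' : set A,
    [/\ S' `<=` S, T' `<=` T, finite_set S', finite_set T'
      & bigmeet (e @` S) <= bigjoin (e @` T) ->
        bigmeet (e @` S') <= bigjoin (e @` T')].

Definition canonical_completion (d d' : Order.disp_t) (A : tbLatticeType d)
    (C : tbLatticeType d') (e : BoundedLatticeMorphism.type A C) : Prop :=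
  [/\ complete_lattice C, injective e, dense_map e & compact_map e].

(* Main.v *)
Require Import Defs.
From mathcomp Require Import all_boot all_order.
From HB Require Import structures.
From mathcomp Require Import boolp classical_sets cardinality.

(** The canonical completion of an ortholattice is the lattice of
    biorthogonally closed sets of its filters.  Call two filters orthogonal
    when one contains some [a] and the other contains [perp a]; let [polar S]
    be the set of filters orthogonal to all of [S], and let [C] consist of the
    sets with [polar (polar S) = S], ordered by inclusion.  This is a complete
    lattice on which [polar] is an orthocomplementation, and [a] is sent to the
    set [e a] of the filters that contain it.

    Density holds because a point [F] of [C], that is, the set of filters
    extending a filter [F], is the meet of the [e a] with [a] in [F]; every
    closed set is the join of its points ([stable_join_points]), and taking
    orthocomplements every closed set is also a meet of joins.  Compactness
    holds because a meet of [e s], [s] in [S], lies below a join of [e t],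
    [t] in [T], only if the filter generated by [S] is orthogonal to the filter
    generated by the [perp t], and membership in a generated filter is
    witnessed by finitely many generators.

    What makes the quantifiers extend is that a quantifier is self-adjoint for
    orthogonality: [cyl i a] is orthogonal to [b] exactly when [a] is
    orthogonal to [cyl i b] ([quantifier_adjoint]).  Hence the map [q] sending a
    filter [F] to the filter generated by its image under [cyl i] satisfies
    the same law on filters, and it is idempotent and shrinks filters.  For any
    such [q] the operation taking [S] to the polar of the preimage by [q] of
    the polar of [S] is a quantifier on [C] ([quantifier_image]).
    The key identity is [polar_image_closure]: the polar of the extended
    quantifier is just a preimage under [q], so composites of extended
    quantifiers are governed by composites of the maps [q], which commute.
    Finally [e] preserves the quantifiers, so with [e (diag i k)] as diagonals
    the axioms on them, which mention nothing outside the image of [e], are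
    inherited from [A]. *)

Set Implicit Arguments.
Unset Strict Implicit.
Unset Printing Implicit Defensive.

Import Order.LTheory.
Local Open Scope order_scope.
Local Open Scope classical_set_scope.

(** * Joins and meets in terms of least upper and greatest lower bounds *)

Section BigJoinMeet.
Variables (d : Order.disp_t) (C : tbLatticeType d).

Lemma bigjoin_supremum (S : set C) (x : C) : supremums S x -> bigjoin S = x.
Proof.
move=> Sx; rewrite /bigjoin /supremum; case: ifPn => [/eqP S0|_].
  by apply/esym/eqP; rewrite -lex0; apply: Sx.2 => y; rewrite S0.
by case: xgetP => [y _ Sy|/(_ x)//]; apply: is_subset1_supremums Sy Sx.
Qed.

Lemma bigmeet_infimum (S : set C) (x : C) : infimums S x -> bigmeet S = x.
Proof.
move=> Sx; rewrite /bigmeet /infimum; case: ifPn => [/eqP S0|_].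
  by apply/esym/eqP; rewrite -le1x; apply: Sx.2 => y; rewrite S0.
by case: xgetP => [y _ Sy|/(_ x)//]; apply: is_subset1_infimums Sy Sx.
Qed.

End BigJoinMeet.

(** * The complete ortholattice of an orthogonality frame *)

(** A point orthogonal to itself, as the improper filter is, has to be
    orthogonal to everything: such points make up the bottom element, which
    gives [S `&` perp S = \bot] without excluding them from the frame. *)
Record orthoframe := Orthoframe {
  point :> Type;
  orth : point -> point -> Prop;
  orth_sym : forall x y, orth x y -> orth y x;
  orth_self : forall x y, orth x x -> orth x y
}.

Definition polar (X : orthoframe) (S : set X) : set X :=
  [set y | forall x, S x -> orth x y].

(** The display [d] is a phantom argument: it lets the lattice be built with
    any prescribed display. *)
Record stable (d : Order.disp_t) (X : orthoframe) := Stable {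
  stable_set :> set X;
  stableP : polar (polar stable_set) = stable_set
}.

Section StableLattice.
Variables (d : Order.disp_t) (X : orthoframe).
Implicit Types S T : set X.
Local Notation C := (stable d X).

Lemma polarS S T : S `<=` T -> polar T `<=` polar S.
Proof. by move=> ST y Ty x /ST; apply: Ty. Qed.

Lemma sub_polarK S : S `<=` polar (polar S).
Proof. by move=> x Sx y Sy; apply: orth_sym; apply: Sy. Qed.

Lemma polar3 S : polar (polar (polar S)) = polar S.
Proof.
by apply/seteqP; split; [apply/polarS/sub_polarK | apply: sub_polarK].
Qed.

Definition of_polar S : C := Stable d (polar3 S).

Lemma stable_eq (U V : C) : U = V :> set X -> U = V.
Proof.
case: U V => [S pS] [T pT] /= ST; move: pS; rewrite ST => pS.
by rewrite (Prop_irrelevance pS pT).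
Qed.

Lemma polar_bigcup (J : Type) (D : set J) (f : J -> set X) :
  polar (\bigcup_(j in D) f j) = \bigcap_(j in D) polar (f j).
Proof.
apply/seteqP; split=> [y fy j Dj x fx|y fy x [j Dj fx]]; last exact: fy fx.
by apply: fy; exists j.
Qed.

Lemma polarU S T : polar (S `|` T) = polar S `&` polar T.
Proof.
apply/seteqP; split=> [y STy|y [Sy Ty] x [/Sy|/Ty]//].
by split=> x ?; apply: STy; [left|right].
Qed.

HB.instance Definition _ := gen_eqMixin C.
HB.instance Definition _ := gen_choiceMixin C.

Let le (U V : C) : bool := `[< stable_set U `<=` stable_set V >].

Let le_refl : reflexive le.
Proof. by move=> U; apply/asboolP. Qed.

Let le_anti : antisymmetric le.
Proof.
by move=> U V /andP[/asboolP UV /asboolP VU]; apply/stable_eq/seteqP.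
Qed.

Let le_trans : transitive le.
Proof.
by move=> V U W /asboolP UV /asboolP VW; apply/asboolP/(subset_trans UV).
Qed.

HB.instance Definition _ :=
  Order.Le_isPOrder.Build d C le_refl le_anti le_trans.

Lemma stable_leP (U V : C) : reflect (stable_set U `<=` V) (U <= V).
Proof. exact: asboolP. Qed.

Lemma stable_bigcapP (F : set C) :
  polar (polar (\bigcap_(U in F) U)) = \bigcap_(U in F) U.
Proof.
have <- : polar (\bigcup_(U in F) polar U) = \bigcap_(U in F) U.
  by rewrite polar_bigcup; apply: eq_bigcapr => U _; apply: stableP.
exact: polar3.
Qed.

Definition stable_inf (F : set C) : C := Stable d (stable_bigcapP F).
Definition stable_sup (F : set C) : C := of_polar (\bigcap_(U in F) polar U).

Lemma stable_inf_infimum (F : set C) : infimums F (stable_inf F).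
Proof.
split=> [U FU|V FV]; first by apply/stable_leP => x; apply.
by apply/stable_leP => x Vx U FU; move/stable_leP: (FV U FU); apply.
Qed.

Lemma stable_sup_supremum (F : set C) : supremums F (stable_sup F).
Proof.
split=> [U FU|V FV]; apply/stable_leP.
  rewrite -[X in X `<=` _]stableP; apply: polarS => x; exact.
rewrite -[X in _ `<=` X]stableP; apply: polarS => x Vx U FU.
by apply: polarS Vx; apply/stable_leP/FV.
Qed.

Let meetP (U V : C) :
  polar (polar (stable_set U `&` V)) = stable_set U `&` V.
Proof. by rewrite -[U : set X]stableP -[V : set X]stableP -polarU polar3. Qed.

Let meet (U V : C) : C := Stable d (meetP U V).
Let join (U V : C) : C := of_polar (polar U `&` polar V).

Let le_meet U V W : (U <= meet V W) = (U <= V) && (U <= W).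
Proof.
apply/stable_leP/andP => [UVW|[/stable_leP UV /stable_leP UW]].
  by split; apply/stable_leP => x /UVW[].
by move=> x Ux; split; [apply: UV|apply: UW].
Qed.

Let join_le U V W : (join U V <= W) = (U <= W) && (V <= W).
Proof.
rewrite /join; apply/stable_leP/andP => /= [UVW|[/stable_leP UW /stable_leP VW]].
  rewrite -polarU in UVW.
  by split; apply/stable_leP => x Ux; apply/UVW/sub_polarK; [left|right].
by rewrite -[X in _ `<=` X]stableP -polarU; apply/polarS/polarS => x [/UW|/VW].
Qed.

HB.instance Definition _ :=
  Order.POrder_MeetJoin_isLattice.Build d C le_meet join_le.

Let bot_le (U : C) : of_polar setT <= U.
Proof. by apply/stable_leP; rewrite -[X in _ `<=` X]stableP; apply: polarS. Qed.

Let le_top (U : C) : U <= of_polar set0.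
Proof. by apply/stable_leP => x _ y. Qed.

HB.instance Definition _ := Order.hasBottom.Build d C bot_le.
HB.instance Definition _ := Order.hasTop.Build d C le_top.

Let perp (U : C) : C := of_polar U.

Let perpK U : perp (perp U) = U.
Proof. exact/stable_eq/stableP. Qed.

Let perp_anti U V : U <= V -> perp V <= perp U.
Proof. by move=> /stable_leP UV; apply/stable_leP/polarS. Qed.

Let meet_perp (U : C) : (U `&` perp U)%O = \bot.
Proof.
apply/le_anti/andP; split; last exact: bot_le.
apply/stable_leP => x [Ux U'x] y _; apply: orth_sym.
by apply: orth_self; apply: U'x.
Qed.

Let join_perp (U : C) : (U `|` perp U)%O = \top.
Proof.
(* By the De Morgan law below this is [meet_perp] for [perp U]. *)
apply: stable_eq; rewrite /= -polarU.
have -> : polar (U `|` polar U) = polar setT.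
  by rewrite polarU; apply: (congr1 (@stable_set d X) (meet_perp (perp U))).
by apply/seteqP; split=> x _; [move=> y | apply: (@sub_polarK setT)].
Qed.

HB.instance Definition _ := isOrtholattice.Build d C
  meet_perp join_perp perp_anti perpK.

Lemma stable_complete : complete_lattice C.
Proof.
move=> F; split; [exists (stable_sup F)|exists (stable_inf F)].
  exact: stable_sup_supremum.
exact: stable_inf_infimum.
Qed.

Lemma polar_join (U V : C) : polar (U `|` V : C)%O = polar U `&` polar V.
Proof. by rewrite -polarU -[RHS]polar3 polarU. Qed.

Lemma polar_bot : polar (\bot : C) = setT.
Proof.
by apply/seteqP; split=> // x _; apply: (@sub_polarK setT).
Qed.

End StableLattice.

(** * Quantifiers induced by self-adjoint maps of a frame *)

Section ImageClosure.
Variables (d : Order.disp_t) (X : orthoframe) (q : X -> X).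
Hypothesis q_adjoint : forall x y, orth (q x) y <-> orth x (q y).
Hypothesis q_idem : forall x, q (q x) = q x.
Hypothesis orth_q : forall x y, orth (q x) y -> orth x y.
Local Notation C := (stable d X).

(** By [preimage_polar] this is the stable closure of the image of [U]. *)
Definition image_closure (U : C) : C := of_polar d (q @^-1` polar U).

Lemma preimage_polar (S : set X) : q @^-1` polar S = polar (q @` S).
Proof.
apply/seteqP; split=> y Sy x; first by case=> z Sz <-; apply/q_adjoint/Sy.
by move=> Sx; apply/q_adjoint/Sy; exists x.
Qed.

(** Not only the closure but its polar is computed by [q], without taking
    polars again: this makes composites of such operations tractable. *)
Lemma polar_image_closure (U : C) : polar (image_closure U) = q @^-1` polar U.
Proof. by rewrite /= preimage_polar polar3. Qed.

Lemma quantifier_image : quantifier image_closure.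
Proof.
have polar_inj (U V : C) : polar U = polar V -> U = V.
  by move=> UV; apply: stable_eq; rewrite -(stableP U) -(stableP V) UV.
split=> [U V||U|U|U].
- by apply: polar_inj; rewrite polar_join !polar_image_closure polar_join.
- by apply: polar_inj; rewrite polar_image_closure polar_bot.
- apply: polar_inj; rewrite !polar_image_closure.
  by apply/funext => x; rewrite /preimage /= q_idem.
- apply/stable_leP; rewrite -[X in X `<=` _]stableP; apply: polarS => y Uy x Ux.
  by apply/orth_sym/orth_q/orth_sym/Uy.
(* [perp (image_closure U)] is [P] below, and [P] is closed under [q]; so the
   polar of [P] is closed under [q] by adjointness.  It is closed under preimages
   by [q] because whatever is orthogonal to [q x] is orthogonal to [x]. *)
- apply: stable_eq => /=; congr polar.
  set P := q @^-1` polar U; rewrite polar3.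
  have qP x : P x -> P (q x) by rewrite /P /preimage /= q_idem.
  apply/seteqP; split=> y Py x Px; first by apply/orth_sym/orth_q/orth_sym/Py.
  by apply/q_adjoint; apply: Py; apply: qP.
Qed.

End ImageClosure.

(** * The frame of filters of an ortholattice *)

Lemma perp_meet (d : Order.disp_t) (A : ortholatticeType d) (a b : A) :
  perp (a `&` b)%O = (perp a `|` perp b)%O.
Proof.
apply/le_anti/andP; split; last by rewrite leUx !perp_anti ?leIl ?leIr.
rewrite -[leRHS]perpK; apply: perp_anti; rewrite lexI.
by apply/andP; split; rewrite -[leRHS]perpK perp_anti ?leUl ?leUr.
Qed.

Record latfilter (d : Order.disp_t) (A : tbLatticeType d) := LatFilter {
  filter_set :> set A;
  filter_top : filter_set \top;
  filter_le : forall a b, a <= b -> filter_set a -> filter_set b;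
  filter_meet : forall a b,
    filter_set a -> filter_set b -> filter_set (a `&` b)%O
}.

Section Filters.
Variables (d : Order.disp_t) (A : tbLatticeType d).

Lemma latfilter_eq (F G : latfilter A) : F = G :> set A -> F = G.
Proof.
case: F G => [F F1 F2 F3] [G G1 G2 G3] /= FG; subst G.
by congr LatFilter; apply: Prop_irrelevance.
Qed.

Definition principal_set (a : A) : set A := [set b | a <= b].

Lemma principal_top a : principal_set a \top. Proof. exact: lex1. Qed.

Lemma principal_le a b c : b <= c -> principal_set a b -> principal_set a c.
Proof. by move=> bc ab; apply: le_trans bc. Qed.

Lemma principal_meet a b c :
  principal_set a b -> principal_set a c -> principal_set a (b `&` c)%O.
Proof. by rewrite /principal_set /= lexI => -> ->. Qed.

Definition principal (a : A) : latfilter A :=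
  LatFilter (principal_top a) (@principal_le a) (@principal_meet a).

(** Generation is expressed by the finite subsets of [S] rather than by finite
    meets, because finite subsets are what compactness asks for. *)
Definition generated_set (S : set A) : set A :=
  [set b | exists S' : set A, [/\ finite_set S', S' `<=` S
         & forall F : latfilter A, S' `<=` F -> filter_set F b]].

Variable S : set A.

Lemma generated_top : generated_set S \top.
Proof. by exists set0; split=> // F _; apply: filter_top. Qed.

Lemma generated_le a b : a <= b -> generated_set S a -> generated_set S b.
Proof.
move=> ab [S' [finS' S'S aP]]; exists S'; split=> // F /aP.
exact: filter_le.
Qed.

Lemma generated_meet a b :
  generated_set S a -> generated_set S b -> generated_set S (a `&` b)%O.
Proof.
move=> [S1 [fin1 S1S aP]] [S2 [fin2 S2S bP]]; exists (S1 `|` S2); split.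
- by rewrite finite_setU.
- by move=> x [/S1S|/S2S].
- by move=> F S12; apply: filter_meet; [apply: aP|apply: bP] => x ?;
    apply: S12; [left|right].
Qed.

Definition generated : latfilter A :=
  LatFilter generated_top generated_le generated_meet.

Lemma sub_generated : S `<=` generated.
Proof.
by move=> a Sa; exists [set a]; split=> [||F]; [|move=> _ ->|apply].
Qed.

End Filters.

Section FilterFrame.
Variables (d : Order.disp_t) (A : ortholatticeType d).

Definition filter_orth (F G : latfilter A) : Prop :=
  exists2 a, filter_set F a & filter_set G (perp a).

Lemma filter_orth_sym F G : filter_orth F G -> filter_orth G F.
Proof. by case=> a Fa Ga; exists (perp a); rewrite ?perpK. Qed.

Lemma filter_orth_self F G : filter_orth F F -> filter_orth F G.
Proof.
case=> a Fa F'a; exists \bot.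
  by rewrite -(meet_perp a); apply: filter_meet.
by rewrite -[perp _]join0x join_perp; apply: filter_top.
Qed.

Definition filter_frame : orthoframe :=
  Orthoframe filter_orth_sym filter_orth_self.

(** This is the finiteness behind compactness: orthogonality of two generated
    filters is witnessed by a single element [a], and finitely many generators
    on each side force [a] and [perp a] into every filter containing them. *)
Lemma generated_orth (S T : set A) :
  orth (generated S : filter_frame) (generated T : filter_frame) ->
  exists S' T' : set A,
    [/\ finite_set S', finite_set T', S' `<=` S, T' `<=` T
      & forall F G : filter_frame, S' `<=` F -> T' `<=` G -> orth F G].
Proof.
case=> a [S' [finS' S'S aP]] [T' [finT' T'T aT]].
by exists S', T'; split=> // F G /aP Fa /aT Ga; exists a.
Qed.

(** * The embedding *)

Local Notation C := (stable d filter_frame).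

Definition hull_set (a : A) : set filter_frame := [set F | filter_set F a].

(** A filter orthogonal to the principal filter of [a] contains [perp b] for
    some [b] above [a], hence contains [perp a]. *)
Lemma polar_hull_set a : polar (hull_set a) = hull_set (perp a).
Proof.
apply/seteqP; split=> F; last by move=> Fa' G Ga; exists a.
move/(_ (principal a) (lexx a)) => [b ab Fb].
by apply: filter_le Fb; apply: perp_anti.
Qed.

Lemma hull_setP a : polar (polar (hull_set a)) = hull_set a.
Proof. by rewrite !polar_hull_set perpK. Qed.

Definition hull (a : A) : C := Stable d (hull_setP a).

Lemma hull_perp a : hull (perp a) = perp (hull a).
Proof. by apply: stable_eq; rewrite /= polar_hull_set. Qed.

Lemma hull_meet : {morph hull : a b / (a `&` b)%O}.
Proof.
move=> a b; apply: stable_eq; apply/seteqP; split=> F /=.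
  by move=> Fab; split; apply: filter_le Fab; [apply: leIl|apply: leIr].
by case=> Fa Fb; apply: filter_meet.
Qed.

Lemma hull_le (a b : A) : (hull a <= hull b) = (a <= b).
Proof.
apply/stable_leP/idP => [/(_ (principal a) (lexx a))//|ab F].
exact: filter_le.
Qed.

Lemma hull_inj : injective hull.
Proof. by move=> a b ab; apply/eqP; rewrite eq_le -!hull_le ab !lexx. Qed.

Lemma hull_join : {morph hull : a b / (a `|` b)%O}.
Proof.
move=> a b; rewrite -[a]perpK -[b]perpK -perp_meet !hull_perp.
by rewrite hull_meet !hull_perp perp_meet.
Qed.

Lemma hull_top : hull \top = \top.
Proof.
apply: stable_eq; apply/seteqP; split=> F _; last exact: filter_top.
by move=> G.
Qed.

Lemma hull_bot : hull \bot = \bot.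
Proof. by rewrite -(meet_perp \top) hull_meet hull_perp hull_top meet_perp. Qed.

(** * Density and compactness *)

Lemma bigmeet_hull (S : set A) :
  stable_set (bigmeet (hull @` S)) = [set F : filter_frame | S `<=` F].
Proof.
rewrite (bigmeet_infimum (stable_inf_infimum _)).
apply/seteqP; split=> F SF.
  by move=> a Sa; apply: (SF (hull a)); exists a.
by move=> _ [a Sa <-]; apply: SF.
Qed.

Lemma bigjoin_hull (T : set A) :
  stable_set (bigjoin (hull @` T)) =
  polar [set F : filter_frame | perp @` T `<=` F].
Proof.
rewrite (bigjoin_supremum (stable_sup_supremum _)); congr (polar _).
apply/seteqP; split=> F TF.
  move=> _ [a Ta <-].
  by have := TF (hull a) (imageP _ Ta); rewrite /= polar_hull_set.
by move=> _ [a Ta <-]; rewrite /= polar_hull_set; apply: TF; exists a.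
Qed.

Lemma stable_up (U : C) (F G : filter_frame) :
  F `<=` G -> stable_set U F -> stable_set U G.
Proof.
move=> FG UF; rewrite -stableP => H UH.
by have [a Ha Fa] : orth H F; [apply/orth_sym/UH|exists a => //; apply: FG].
Qed.

(** Closed sets are upward closed, so [U] is the union of the sets of filters
    extending a given [F] in [U], each of which is a meet of images of [hull]. *)
Lemma stable_join_points (U : C) :
  U = bigjoin [set bigmeet (hull @` F) | F in [set filter_set F | F in U]].
Proof.
apply/esym/bigjoin_supremum; split=> [_ [_ [F UF <-] <-]|V UV].
  by apply/stable_leP; rewrite bigmeet_hull => G FG; apply: stable_up UF.
apply/stable_leP => F UF.
have /stable_leP : bigmeet (hull @` F) <= V.
  by apply: UV; exists F => //; exists F.
by apply; rewrite bigmeet_hull.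
Qed.

(** This is the orthocomplemented form of [stable_join_points] for [perp U]: the
    orthocomplement of the point [F] is the join of the [hull (perp a)] with [a]
    in [F]. *)
Lemma stable_meet_copoints (U : C) :
  U = bigmeet [set bigjoin (hull @` T)
                | T in [set perp @` filter_set F | F in polar U]].
Proof.
have perpF (F : latfilter A) :
    perp @` (perp @` F) = filter_set F.
  apply/seteqP; split=> [_ [_ [a Fa <-] <-]|a Fa]; first by rewrite perpK.
  by exists (perp a); rewrite ?perpK //; exists a.
apply/esym/bigmeet_infimum; split=> [_ [_ [F UF <-] <-]|V UV].
  apply/stable_leP; rewrite bigjoin_hull perpF -[X in X `<=` _]stableP.
  by apply: polarS => G FG; apply: (@stable_up (perp U)) UF.
apply/stable_leP; rewrite -[X in _ `<=` X]stableP => G VG F UF.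
have /stable_leP : V <= bigjoin (hull @` (perp @` F)).
  by apply: UV; exists (perp @` F) => //; exists F.
by move=> /(_ G VG); rewrite bigjoin_hull perpF; apply.
Qed.

Lemma hull_dense : dense_map hull.
Proof.
move=> U; split.
  exists [set perp @` filter_set F | F in polar U].
  exact: stable_meet_copoints.
by exists [set filter_set F | F in stable_set U]; apply: stable_join_points.
Qed.

Lemma hull_compact : compact_map hull.
Proof.
move=> S T; have [ST|nST] :=
  pselect (bigmeet (hull @` S) <= bigjoin (hull @` T));
  last by exists set0, set0; split.
have /generated_orth : orth (generated (perp @` T) : filter_frame)
                            (generated S : filter_frame).
  move/stable_leP: ST => /(_ (generated S)).
  by rewrite bigmeet_hull bigjoin_hull; apply; apply: sub_generated.
move=> [T' [S' [finT' finS' T'T S'S orthST]]].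
have perpT'T : perp @` T' `<=` T.
  by move=> _ [_ /T'T[a Ta <-] <-]; rewrite perpK.
exists S', (perp @` T'); split=> //; first exact: finite_image.
move=> _; apply/stable_leP; rewrite bigmeet_hull bigjoin_hull => F S'F G T'G.
apply: orthST => // a T'a; apply: T'G.
by exists (perp a); rewrite ?perpK //; exists a.
Qed.

End FilterFrame.

(** * Extending the quantifiers *)

Section CylinderFilter.
Variables (d : Order.disp_t) (A : ortholatticeType d) (q : A -> A).
Hypothesis qP : quantifier q.

Let q_ge a : a <= q a. Proof. by case: qP. Qed.
Let q_idem a : q (q a) = q a. Proof. by case: qP. Qed.
Let q_perp a : q (perp (q a)) = perp (q a). Proof. by case: qP. Qed.

Lemma quantifier_le a b : a <= b -> q a <= q b.
Proof. by case: qP => qU _ _ _ _ /join_idPl <-; rewrite joinC qU leUl. Qed.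

(** The elements [perp (q b)] are fixed by [q], so that [a <= perp (q b)] is
    inherited by [q a]; the converse exchanges the roles of [a] and [b]. *)
Lemma quantifier_adjoint a b : q a <= perp b <-> a <= perp (q b).
Proof.
have half x y : x <= perp (q y) -> q x <= perp y.
  move=> /quantifier_le; rewrite q_perp => qxy.
  by apply: le_trans qxy _; apply: perp_anti.
split; last exact: half.
have swap x y : x <= perp y -> y <= perp x.
  by move=> /perp_anti; rewrite perpK.
by move=> /swap/half/swap.
Qed.

Definition image_filter_set (F : latfilter A) : set A :=
  [set b | exists2 a, filter_set F a & q a <= b].

Lemma image_filter_top F : image_filter_set F \top.
Proof. by exists \top; [apply: filter_top|apply: lex1]. Qed.

Lemma image_filter_le F a b :
  a <= b -> image_filter_set F a -> image_filter_set F b.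
Proof. by move=> ab [c Fc ca]; exists c => //; apply: le_trans ab. Qed.

Lemma image_filter_meet F a b :
  image_filter_set F a -> image_filter_set F b ->
  image_filter_set F (a `&` b)%O.
Proof.
move=> [a' Fa' qa'] [b' Fb' qb']; exists (a' `&` b')%O.
  exact: filter_meet.
rewrite lexI (le_trans _ qa') ?(le_trans _ qb') //;
  by apply: quantifier_le; rewrite ?leIl ?leIr.
Qed.

Definition image_filter (F : filter_frame A) : filter_frame A :=
  LatFilter (@image_filter_top F) (@image_filter_le F) (@image_filter_meet F).

Lemma sub_image_filter (F : filter_frame A) : image_filter F `<=` F.
Proof. by move=> b [a Fa ab]; apply: filter_le ab _; apply: filter_le Fa. Qed.

Lemma orth_image_filter (F G : filter_frame A) :
  orth (image_filter F) G -> orth F G.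
Proof. by case=> a /sub_image_filter Fa Ga; exists a. Qed.

Lemma image_filter_idem F : image_filter (image_filter F) = image_filter F.
Proof.
apply: latfilter_eq; apply/seteqP; split; first exact: sub_image_filter.
move=> b [a Fa ab]; exists (q a); last by rewrite q_idem.
by exists a.
Qed.

(** If [a] in [F] makes [image_filter F] orthogonal to [G], then
    [perp (q a)] is in [G] and, being fixed by [q], also in [image_filter G],
    whereas [q a] is in [F]. *)
Lemma image_filter_adjoint (F G : filter_frame A) :
  orth (image_filter F) G <-> orth F (image_filter G).
Proof.
have half F' G' : orth (image_filter F') G' -> orth F' (image_filter G').
  move=> [b [a Fa ab] Gb]; exists (q a); first exact: filter_le Fa.
  exists (perp (q a)); last by rewrite q_perp.
  by apply: filter_le Gb; apply: perp_anti.
by split=> [/half//|/orth_sym/half/orth_sym].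
Qed.

Definition extension : stable d (filter_frame A) -> stable d (filter_frame A) :=
  image_closure image_filter.

Lemma quantifier_extension : quantifier extension.
Proof.
apply: quantifier_image; first exact: image_filter_adjoint.
  exact: image_filter_idem.
exact: orth_image_filter.
Qed.

Lemma hull_extension a : hull (q a) = extension (hull a).
Proof.
rewrite -[hull _]perpK -[RHS]perpK; congr perp; rewrite -hull_perp.
apply: stable_eq.
rewrite [RHS](polar_image_closure image_filter_adjoint) polar_hull_set.
apply/seteqP; split=> F /=.
  move=> Fqa; exists (perp (q a)) => //.
  by rewrite q_perp; apply: perp_anti.
by case=> c Fc /quantifier_adjoint cqa; apply: filter_le cqa Fc.
Qed.

End CylinderFilter.

(** Polars turn the composites of the extensions into preimages under composites
    of the maps on filters, and these commute because [q] and [r] do. *)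
Lemma extensionC (d : Order.disp_t) (A : ortholatticeType d) (q r : A -> A)
    (qP : quantifier q) (rP : quantifier r) :
  (forall a, q (r a) = r (q a)) ->
  forall U, extension qP (extension rP U) = extension rP (extension qP U).
Proof.
move=> qrC U; apply: stable_eq; congr polar.
rewrite !(polar_image_closure (image_filter_adjoint _)).
have image_filterC (q' r' : A -> A)
    (q'P : quantifier q') (r'P : quantifier r') :
    (forall a, q' (r' a) = r' (q' a)) -> forall F : filter_frame A,
    image_filter q'P (image_filter r'P F) `<=`
    image_filter r'P (image_filter q'P F).
  move=> q'r'C F c [b [a Fa ab] bc]; exists (q' a); first by exists a.
  by rewrite -q'r'C (le_trans _ bc) //; apply: quantifier_le.
apply/funext => F; rewrite /preimage /=; congr (polar U _).
apply: latfilter_eq; apply/seteqP; split; exact: image_filterC.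
Qed.

(** * The cylindric completion *)

Section Completion.
Variables (I : Type) (d : Order.disp_t) (A : cylindricOrtholatticeType I d).

(** A copy of the lattice of closed sets on which the operators indexed by [I]
    can be installed: the closed sets by themselves do not determine [I]. *)
Definition completion : Type := stable d (filter_frame A).

HB.instance Definition _ :=
  Ortholattice.copy completion (stable d (filter_frame A)).

Definition completion_cyl (i : I) : completion -> completion :=
  extension (@cyl_quantifier I d A i).

Definition completion_diag (i k : I) : completion := hull (diag i k).

Let cylC_ i k U :
  completion_cyl i (completion_cyl k U) = completion_cyl k (completion_cyl i U).
Proof. by apply: extensionC => a; apply: cylC. Qed.

Let diagC_ i k : completion_diag i k = completion_diag k i.
Proof. by rewrite /completion_diag diagC. Qed.

Let diag_refl_ i : completion_diag i i = \top.
Proof. by rewrite /completion_diag diag_refl hull_top. Qed.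

Let cyl_diag_ i k l : i <> k -> l <> k ->
  completion_cyl k (completion_diag i k `&` completion_diag k l)%O =
  completion_diag i l.
Proof.
move=> ik lk; rewrite /completion_diag /completion_cyl.
rewrite -(cyl_diag i k l ik lk).
by rewrite (hull_extension (cyl_quantifier k)) hull_meet.
Qed.

HB.instance Definition _ := isCylindric.Build I d completion
  (fun i => quantifier_extension (cyl_quantifier i)) cylC_ diagC_ diag_refl_
  cyl_diag_.

Definition completion_map : A -> completion := @hull d A.

Let completion_map_le : {homo completion_map : a b / a <= b}.
Proof. by move=> a b ab; rewrite hull_le. Qed.

HB.instance Definition _ :=
  Order.isOrderMorphism.Build d A d completion completion_map completion_map_le.
HB.instance Definition _ :=
  Order.isMeetLatticeMorphism.Build d A d completion completion_map
    (@hull_meet d A).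
HB.instance Definition _ :=
  Order.isJoinLatticeMorphism.Build d A d completion completion_map
    (@hull_join d A).
HB.instance Definition _ :=
  Order.isBLatticeMorphism.Build d A d completion completion_map (@hull_bot d A).
HB.instance Definition _ :=
  Order.isTLatticeMorphism.Build d A d completion completion_map (@hull_top d A).
HB.instance Definition _ :=
  isCylindricMorphism.Build I d A d completion completion_map (@hull_perp d A)
    (fun i => hull_extension (cyl_quantifier i)) (fun i k => erefl).

End Completion.

Theorem corollary3p7 (I : Type) (d : Order.disp_t)
    (A : cylindricOrtholatticeType I d) :
  exists (C : cylindricOrtholatticeType I d) (e : CylindricMorphism.type A C),
    injective e /\ canonical_completion e.
Proof.
exists (completion A), (@completion_map I d A); split; first exact: hull_inj.
split; first exact: stable_complete.
- exact: hull_inj.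
- exact: hull_dense.
- exact: hull_compact.
Qed.
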